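(* Let $f:[0,1]\to[0,1]$ and $g:[0,1]\to[0,1]$ be approximately continuous functions. Then $f\circ g$ has a fixed point, i.e. there exists $x\in[0,1]$ with $f(g(x))=x$.
   Context: A function $f:[0,1]\to\mathbb{R}$ is approximately continuous if for every $x\in[0,1]$ there is a Lebesgue measurable set $E\subset[0,1]$ containing $x$ and having Lebesgue density $1$ at $x$ (density relative to $[0,1]$, so one-sided at the endpoints) such that the restriction $f|_E$ is continuous at $x$. *)

(* Defs.v *)
From HB Require Import structures.
From mathcomp Require Import all_boot all_order all_algebra.
From mathcomp Require Import all_classical all_reals all_analysis.

Set Implicit Arguments.
Unset Strict Implicit.
Unset Printing Implicit Defensive.

Import Order.TTheory GRing.Theory Num.Theory.
Import numFieldNormedType.Exports.

Local Open Scope classical_set_scope.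
Local Open Scope ring_scope.

(* [measurable] on R is the Borel sigma-algebra; the Lebesgue measurable sets
   are the Caratheodory-measurable sets of the outer measure generated by
   interval length, i.e. the domain of [completed_lebesgue_measure]
   (see [completed_caratheodory_measurable]). *)
Definition lebesgue_measurable (R : realType) (E : set R) : Prop :=
  (@wlength R idfun)^*%mu.-cara.-measurable E.

(* Density of E at x relative to D: for D = [0, 1] it is two-sided at interior
   points and one-sided at 0 and 1. *)
Definition has_density_in (R : realType) (D E : set R) (x d : R) : Prop :=
  (completed_lebesgue_measure (E `&` ball x r) *
   (completed_lebesgue_measure (D `&` ball x r))^-1)%E
    @[r --> 0^'+] --> d%:E.

(* A function on [0, 1] is represented by a function on R whose values outside
   [0, 1] are irrelevant. *)
Definition approximately_continuous (R : realType) (f : R -> R) : Prop :=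
  forall x : R, x \in `[0, 1] ->
    exists E : set R,
      [/\ lebesgue_measurable E, E `<=` `[0, 1], E x,
          has_density_in `[0, 1] E x 1
        & f y @[y --> within E (nbhs x)] --> f x].

(* Main.v *)
(* Suppose that [f \o g] has no fixed point. The vector field
   [(y - g x, x - f y)] then has no zero in the unit square, and although it is
   discontinuous it has a (clockwise) winding number along the boundary of every
   rectangle, because on each side one of its components changes sign only once.
   This index is additive under subdivision and equals 1 for the whole square.

   As [f] and [g] are Baire one, the square is a countable union of closed sets
   of the form [{(x, y) | x \in C, q <= y}] with [g < q] on the closed set [C],
   and of the analogous sets for the three other strict inequalities between [y]
   and [g x] or [x] and [f y]. A rectangle of nonzero index contains one of
   nonzero index that avoids a given such set: if all rectangles avoiding it had
   index 0, then as a function of the position of a vertical side the index would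
   be constant on the gaps of [C], while on [{g < q}] it coincides with a function
   that is locally constant there; as the points of [{g < q}] accumulate at every
   point of [C] from both sides, by the density condition, the index would be
   constant, hence 0. Nested rectangles avoiding all these sets in turn then have
   a common point outside their union, a contradiction. *)

Require Import Defs.
From mathcomp Require Import all_boot all_order all_algebra.
From mathcomp Require Import all_classical all_reals all_analysis.
From mathcomp Require Import ring lra.
Set Implicit Arguments.
Unset Strict Implicit.
Unset Printing Implicit Defensive.

Import Order.TTheory GRing.Theory Num.Theory.
Import numFieldNormedType.Exports.

Local Open Scope classical_set_scope.
Local Open Scope ring_scope.

(** * Density estimates for approximately continuous functions *)

Section ApproximatelyContinuous.
Context {R : realType}.
Implicit Types (E S : set R) (f : R -> R) (x r p : R).

Local Notation lam := ((@wlength R idfun)^*%mu).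
Local Notation I01 := (`[0, 1]%classic : set R).

Lemma outer_lebesgue_itv (i : interval R) :
  lam [set` i] = (if i.1 < i.2 then (i.2 : \bar R) - i.1 else 0)%E.
Proof. exact: lebesgue_measure_itv. Qed.

(** Since [r <= 2^-1], the right or the left half of the ball stays inside the unit interval, whence
    the lower bound. *)
Lemma outer_lebesgue_unit_ball x r : 0 <= x <= 1 -> 0 < r <= 2^-1 ->
  exists2 v : R, r <= v <= r * 2 & lam (I01 `&` ball x r) = v%:E.
Proof.
move=> /andP[x0 x1] /andP[r0 r2].
have le_v : (lam (I01 `&` ball x r) <= (r * 2)%:E)%E.
  rewrite mulr_natr -(lebesgue_measure_ball x (ltW r0)).
  exact: le_mu_ext (@subIsetr _ _ _).
have ge_v : (r%:E <= lam (I01 `&` ball x r))%E.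
  have [x2|x2] := leP x 2^-1.
    have -> : r%:E = lam (`[x, x + r[%classic : set R).
      rewrite outer_lebesgue_itv /= lte_fin ltrDl r0 -EFinB.
      by congr (_%:E); ring.
    apply: le_mu_ext => t /=; rewrite in_itv/= => /andP[xt tx].
    split; first by rewrite /= in_itv/=; lra.
    by rewrite ball_itv /= in_itv/=; lra.
  have -> : r%:E = lam (`]x - r, x]%classic : set R).
    rewrite outer_lebesgue_itv /= lte_fin gtrBl r0 -EFinB.
    by congr (_%:E); ring.
  apply: le_mu_ext => t /=; rewrite in_itv/= => /andP[xt tx].
  split; first by rewrite /= in_itv/=; lra.
  by rewrite ball_itv /= in_itv/=; lra.
move: le_v ge_v; case: (lam _) => // v; rewrite !lee_fin => le_v ge_v.
by exists v => //; apply/andP.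
Qed.

(** If the relative ball has measure [v], with [r <= v <= r * 2], density above 3/4 leaves [E] more
    than [3v/4 > r/2] and its complement less than [v/4 <= r/2]. This common threshold later
    separates [{p < f}] from [{f < p}]. *)
Lemma density_bounds E x : lebesgue_measurable E -> E `<=` I01 ->
  0 <= x <= 1 -> has_density_in I01 E x 1 ->
  exists2 d : R, 0 < d & forall r, 0 < r < d ->
    ((r / 2)%:E < lam (E `&` ball x r))%E /\
    (lam ((I01 `&` ball x r) `\` E) <= (r / 2)%:E)%E.
Proof.
move=> mE sE x01 dE.
have : \forall r \near 0^'+, ((3 / 4 : R)%:E <
   completed_lebesgue_measure (E `&` ball x r) *
   (completed_lebesgue_measure (I01 `&` ball x r))^-1)%E.
  apply: (dE [set z | ((3 / 4 : R)%:E < z)%E]).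
  apply: open_nbhs_nbhs; split; first exact: open_ereal_gt_ereal.
  by rewrite /= lte_fin; lra.
move=> [d /= d0 dP]; exists (Num.min d 2^-1); first by rewrite lt_min d0/=; lra.
move=> r; rewrite lt_min => /and3P[r0 rd r2].
have [|v /andP[rv v2r] vE] := @outer_lebesgue_unit_ball x r x01.
  by rewrite r0 ltW.
have v0 : 0 < v by exact: lt_le_trans rv.
have := dP r; rewrite /= sub0r normrN gtr0_norm// => /(_ rd r0).
have -> : completed_lebesgue_measure (I01 `&` ball x r) = v%:E by [].
rewrite inver gt_eqF// lte_pdivlMr// -EFinM => ltE.
have vD : lam (I01 `&` ball x r) = (lam (I01 `&` ball x r `&` E) +
    lam (I01 `&` ball x r `\` E))%E by exact: mE.
rewrite vE setIAC (setIidr sE) in vD.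
have le0D : (0 <= lam ((I01 `&` ball x r) `\` E))%E by exact: mu_ext_ge0.
move: ltE vD le0D.
rewrite -[completed_lebesgue_measure _]/(lam _).
case: (lam (E `&` ball x r)) => [l| |] //; last first.
  by move=> _; case: (lam _).
case: (lam _) => // k.
rewrite !lte_fin -EFinD => ltE [vlk]; rewrite !lee_fin => k0.
by split; lra.
Qed.

(** Close to [x] the density set lies in [A], so monotonicity of the outer measure carries the
    bounds over to [A], whose measurability is not known. *)
Lemma approximately_continuous_near f x (eps : R) :
  approximately_continuous f -> 0 <= x <= 1 -> 0 < eps ->
  exists2 d : R, 0 < d & forall r, 0 < r < d ->
    let A := [set t | 0 <= t <= 1 /\ `|f t - f x| < eps] in
    ((r / 2)%:E < lam (A `&` ball x r))%E /\
    (lam ((I01 `&` ball x r) `\` A) <= (r / 2)%:E)%E.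
Proof.
move=> f_ac x01 e0.
have [|E [mE sE Ex dE /cvgrPdist_lt/(_ _ e0)[/= d2 d20 fE]]] := f_ac x.
  by rewrite in_itv.
have [d1 d10 d1P] := density_bounds mE sE x01 dE.
exists (Num.min d1 d2); first by rewrite lt_min d10.
move=> r; rewrite lt_min => /and3P[r0 r1 r2].
set A := [set t | _].
have EA : E `&` ball x r `<=` A.
  move=> t [Et xt]; split; first by move: (sE _ Et); rewrite /= in_itv.
  by rewrite distrC; apply: fE => //; exact: lt_trans r2.
have [lt1 le2] := d1P _ (introT andP (conj r0 r1)).
split.
  apply: lt_le_trans lt1 _; apply: le_mu_ext => t Et; split; last exact: Et.2.
  exact: EA.
apply: le_trans le2; apply: le_mu_ext => t [t1 nA]; split => // Et.
by apply: nA; apply: EA; split => //; exact: t1.2.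
Qed.

(** The half-ball []x, x + r[] has measure [r], too much for the complement of the good set, which
    fills at most [r / 2]. *)
Lemma approximately_continuous_right f x (eps d : R) :
  approximately_continuous f -> 0 <= x < 1 -> 0 < eps -> 0 < d ->
  exists2 t, x < t < x + d & 0 <= t <= 1 /\ `|f t - f x| < eps.
Proof.
move=> f_ac /andP[x0 x1] e0 d0.
have [|d1 d10 d1P] := @approximately_continuous_near f x eps f_ac _ e0.
  by rewrite x0 ltW.
pose r := Num.min (Num.min d1 d) (1 - x) / 2.
have : 0 < Num.min (Num.min d1 d) (1 - x) by rewrite !lt_min d10 d0 subr_gt0.
have : Num.min (Num.min d1 d) (1 - x) <= Num.min d1 d by rewrite ge_min lexx.
have : Num.min d1 d <= d1 by rewrite ge_min lexx.
have : Num.min d1 d <= d by rewrite ge_min lexx orbT.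
have : Num.min (Num.min d1 d) (1 - x) <= 1 - x by rewrite ge_min lexx orbT.
move=> rx rd rd1 rm m0.
have [|_ le2] := d1P r; first by rewrite /r; apply/andP; split; lra.
have [//|nex] :=
  pselect (exists2 t, x < t < x + d & 0 <= t <= 1 /\ `|f t - f x| < eps).
exfalso; move: le2; apply/negP; rewrite -ltNge.
apply: (@lt_le_trans _ _ (lam (`]x, (x + r)[%classic : set R))).
  rewrite outer_lebesgue_itv /= lte_fin -EFinB.
  by rewrite ifT ?lte_fin /r; lra.
apply: le_mu_ext => t /=; rewrite in_itv/= => /andP[xt tr].
have rE : r * 2 = Num.min (Num.min d1 d) (1 - x) by rewrite /r; lra.
split.
  split; first by rewrite /= in_itv/=; lra.
  by rewrite ball_itv /= in_itv/=; lra.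
by move=> At; apply: nex; exists t => //; apply/andP; split; lra.
Qed.

Lemma approximately_continuous_left f x (eps d : R) :
  approximately_continuous f -> 0 < x <= 1 -> 0 < eps -> 0 < d ->
  exists2 t, x - d < t < x & 0 <= t <= 1 /\ `|f t - f x| < eps.
Proof.
move=> f_ac /andP[x0 x1] e0 d0.
have [|d1 d10 d1P] := @approximately_continuous_near f x eps f_ac _ e0.
  by rewrite x1 ltW.
pose r := Num.min (Num.min d1 d) x / 2.
have : 0 < Num.min (Num.min d1 d) x by rewrite !lt_min d10 d0.
have : Num.min (Num.min d1 d) x <= Num.min d1 d by rewrite ge_min lexx.
have : Num.min d1 d <= d1 by rewrite ge_min lexx.
have : Num.min d1 d <= d by rewrite ge_min lexx orbT.
have : Num.min (Num.min d1 d) x <= x by rewrite ge_min lexx orbT.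
move=> rx rd rd1 rm m0.
have [|_ le2] := d1P r; first by rewrite /r; apply/andP; split; lra.
have [//|nex] :=
  pselect (exists2 t, x - d < t < x & 0 <= t <= 1 /\ `|f t - f x| < eps).
exfalso; move: le2; apply/negP; rewrite -ltNge.
apply: (@lt_le_trans _ _ (lam (`](x - r), x[%classic : set R))).
  rewrite outer_lebesgue_itv /= lte_fin -EFinB.
  by rewrite ifT ?lte_fin /r; lra.
apply: le_mu_ext => t /=; rewrite in_itv/= => /andP[xt tr].
have rE : r * 2 = Num.min (Num.min d1 d) x by rewrite /r; lra.
split.
  split; first by rewrite /= in_itv/=; lra.
  by rewrite ball_itv /= in_itv/=; lra.
by move=> At; apply: nex; exists t => //; apply/andP; split; lra.
Qed.

Lemma open_outer_lebesgue_ball_gt S (s : R) :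
  open [set x | exists2 r, 0 < r < s & ((r / 2)%:E < lam (S `&` ball x r))%E].
Proof.
rewrite openE => x [r /andP[r0 rs]].
have : (lam (S `&` ball x r) <= (r *+ 2)%:E)%E.
  rewrite -(lebesgue_measure_ball x (ltW r0)).
  exact: le_mu_ext (@subIsetr _ _ _).
case lE : (lam (S `&` ball x r)) => [l| |] //; rewrite lee_fin lte_fin => _ rl.
(* For [y] within [e] of [x], the ball of radius [r + e] at [y] contains [ball x r]; this [e] keeps
   [r + e] below [s] and [(r + e) / 2] below [l]. *)
pose e := Num.min (s - r) (l * 2 - r) / 2.
have : 0 < Num.min (s - r) (l * 2 - r) by rewrite lt_min; lra.
have : Num.min (s - r) (l * 2 - r) <= s - r by rewrite ge_min lexx.
have : Num.min (s - r) (l * 2 - r) <= l * 2 - r by rewrite ge_min lexx orbT.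
move=> e1 e2 e3.
apply/nbhs_ballP; exists e; first by rewrite /= /e; lra.
move=> y xy; exists (r + e); first by apply/andP; split; rewrite /e; lra.
apply: (@lt_le_trans _ _ (lam (S `&` ball x r))).
  by rewrite lE lte_fin /e; lra.
apply: le_mu_ext => t [St xt]; split => //.
by rewrite addrC; apply: ball_triangle xt; exact: ball_sym.
Qed.

(* At a point of [{f < p}] the set [{p <= f}] fills at most a quarter of every
   small enough ball; this condition is closed once the bound on the radius is
   fixed, and a point of [{p < f}] violates it, even at an endpoint of [0, 1]. *)
Lemma approximately_continuous_Fsigma f p : approximately_continuous f ->
  exists C : nat -> set R,
    [/\ forall n, closed (C n),
        forall n x, C n x -> 0 <= x <= 1 -> f x <= p
      & forall x, 0 <= x <= 1 -> f x < p -> exists n, C n x].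
Proof.
move=> f_ac; pose S := [set t | 0 <= t <= 1 /\ p <= f t].
exists (fun n => ~` [set x | exists2 r, 0 < r < n.+1%:R^-1 &
  ((r / 2)%:E < lam (S `&` ball x r))%E]); split=> [n|n x|x x01 fxp].
- by apply: open_closedC; exact: open_outer_lebesgue_ball_gt.
- move=> Cx x01; rewrite leNgt; apply/negP => pfx; apply: Cx.
  have [|d d0 dP] := @approximately_continuous_near f x (f x - p) f_ac x01.
    by rewrite subr_gt0.
  have : (0 : R) < n.+1%:R^-1 by rewrite invr_gt0 ltr0n.
  move: (n.+1%:R^-1 : R) => s s0.
  have : 0 < Num.min d s by rewrite lt_min d0.
  have : Num.min d s <= d by rewrite ge_min lexx.
  have : Num.min d s <= s by rewrite ge_min lexx orbT.
  move=> m1 m2 m3; exists (Num.min d s / 2).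
    by apply/andP; split; lra.
  have [|lt1 _] := dP (Num.min d s / 2).
    by apply/andP; split; lra.
  apply: lt_le_trans lt1 _; apply: le_mu_ext => t [[t01 ft] xt].
  by split => //; split => //; move: ft; rewrite ltr_norml => /andP[? ?]; lra.
have [|d d0 dP] := @approximately_continuous_near f x (p - f x) f_ac x01.
  by rewrite subr_gt0.
(* This index makes the radius bound [n.+1%:R^-1] smaller than [d]. *)
exists (Num.truncn d^-1) => -[r /andP[r0 rn]]; apply/negP; rewrite -leNgt.
have [|_ le2] := dP r.
  rewrite r0 (lt_trans rn)// -[ltRHS]invrK ltf_pV2 ?posrE ?invr_gt0 ?ltr0n//.
  by rewrite truncnS_gt.
apply: le_trans le2; apply: le_mu_ext => t [[t01 pft] xt].
split; first by split; rewrite // in_itv.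
by move=> [_]; rewrite ltr_norml => /andP[? ?]; lra.
Qed.

Lemma approximately_continuousN f :
  approximately_continuous f -> approximately_continuous (\- f).
Proof.
move=> f_ac x x01; have [E [? ? ? ? fE]] := f_ac x x01.
by exists E; split => //; exact: cvgN.
Qed.

End ApproximatelyContinuous.

(** * Functions that are locally constant off a closed set *)

Section LocallyConstant.
Context {R : realType} {T : Type}.
Implicit Types (F G : R -> T) (X A : set R) (a b x y : R).

(** Connectedness of the interval: local constancy at [sup S] extends the equality beyond it, unless
    [b] has been reached. *)
Lemma locally_constant_eq F a b : a <= b ->
  (forall x, a <= x <= b ->
     exists2 e : R, 0 < e & forall y, a <= y <= b -> `|y - x| < e -> F y = F x) ->
  F a = F b.
Proof.
move=> ab Fx; pose S := [set x | a <= x <= b /\ forall y, a <= y <= x -> F y = F a].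
have Sa : S a.
  split; first by rewrite lexx.
  by move=> y /andP[ay ya]; congr F; apply/le_anti/andP.
have ubS : ubound S b by move=> x [/andP[]].
have hS : has_sup S by split; [exists a | exists b].
have sab : a <= sup S <= b.
  apply/andP; split; first by apply: ub_le_sup => //; exists b.
  by apply: ge_sup => //; exists a.
have [e e0 eF] := Fx _ sab.
have [x [/andP[ax xb] xF] sx] := sup_adherent e0 hS.
have xs : x <= sup S by apply: ub_le_sup; [exists b | split => //; exact/andP].
have FE y : a <= y <= b -> y < sup S + e -> F y = F a.
  move=> /andP[ay yb] ys; have [yx|xy] := leP y x; first by apply: xF; exact/andP.
  rewrite (eF y) ?ay ?yb//; last by rewrite ltr_norml; apply/andP; split; lra.
  rewrite -(eF x) ?ax ?xb//; last by rewrite ltr_norml; apply/andP; split; lra.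
  by apply: xF; rewrite ax lexx.
have [bs|sb] := ltP b (sup S + e); first by rewrite FE ?ab ?lexx.
suff : sup S + e / 2 <= sup S by move=> ?; exfalso; lra.
apply: ub_le_sup; first by exists b.
split; first by apply/andP; split; lra.
by move=> y /andP[ay ys]; apply: FE; [apply/andP; split; lra | lra].
Qed.

Lemma closed_last_point X x y : closed X -> x <= y -> X x -> ~ X y ->
  exists2 p, x <= p < y & X p /\ forall t, p < t <= y -> ~ X t.
Proof.
move=> cX xy Xx nXy; pose S := X `&` `[x, y].
have Sx : S x by split => //; rewrite /= in_itv/= lexx.
have ubS : ubound S y by move=> t [_]; rewrite /= in_itv/= => /andP[].
have [Xp] : S (sup S).
  have : closed S by apply: closedI => //; exact: interval_closed.
  by apply; apply: closure_sup; [exists x | exists y].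
rewrite /= in_itv/= => /andP[xp py]; exists (sup S).
  by rewrite xp lt_neqAle py andbT; apply/eqP => pE; rewrite pE in Xp.
split => // t /andP[pt ty] Xt; suff : t <= sup S by rewrite leNgt pt.
apply: ub_le_sup; first by exists y.
by split => //; rewrite /= in_itv/= ty (le_trans xp (ltW pt)).
Qed.

Lemma closed_first_point X x y : closed X -> x <= y -> ~ X x -> X y ->
  exists2 p, x < p <= y & X p /\ forall t, x <= t < p -> ~ X t.
Proof.
move=> cX xy nXx Xy.
have cNX : closed (-%R @^-1` X) by apply: preimage_closed => // t _; exact: opp_continuous.
have [||||p /andP[yp px] [Xp Xt]] := @closed_last_point (-%R @^-1` X) (- y) (- x).
- exact: cNX.
- by rewrite lerN2.
- by rewrite /= opprK.
- by rewrite /= opprK.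
exists (- p); first by apply/andP; split; lra.
split=> // t /andP[xt tp]; rewrite -(opprK t); apply: Xt.
by apply/andP; split; lra.
Qed.

(* From a point of [A] just outside [X], the constancy of [F] off [X] leads back
   along the gap of [X] to a point of [A] next to its end, where [G] takes over. *)
Lemma constant_off_closed F G X A a b : a <= b -> closed X ->
  (forall x, a <= x <= b -> X x -> A x) ->
  (forall x d, a <= x < b -> A x -> 0 < d -> exists2 t, x < t < x + d & A t) ->
  (forall x d, a < x <= b -> A x -> 0 < d -> exists2 t, x - d < t < x & A t) ->
  (forall x, a <= x <= b -> A x -> F x = G x /\ \forall t \near x, G t = G x) ->
  (forall x y, a <= x -> x <= y -> y <= b ->
    (forall t, x <= t <= y -> ~ X t) -> F x = F y) ->
  F a = F b.
Proof.
move=> ab cX XA Ar Al FG FX; apply: locally_constant_eq => // x xab.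
have /andP[ax xb] := xab.
have [Xx|nXx] := pselect (X x); last first.
  have /nbhs_ballP[e /= e0 eX] : nbhs x (~` X).
    by apply: open_nbhs_nbhs; split => //; exact: closed_openC.
  exists e => // y /andP[ay yb] yx.
  have eX' t : `|t - x| < e -> ~ X t.
    by move=> tx; apply: eX; rewrite /ball/= distrC.
  move: yx; rewrite ltr_norml => /andP[? ?].
  have [xy|/ltW yx] := leP x y.
    apply/esym/FX => // t /andP[xt ty]; apply: eX'.
    by rewrite ltr_norml; apply/andP; split; lra.
  apply/FX => // t /andP[xt ty]; apply: eX'.
  by rewrite ltr_norml; apply/andP; split; lra.
have Ax := XA _ xab Xx.
have [Fx /nbhs_ballP[e /= e0 eG]] := FG _ xab Ax.
have {}eG t : `|t - x| < e -> G t = G x.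
  by move=> tx; apply: eG; rewrite /ball/= distrC.
exists e => // y yab yx.
have [Xy|nXy] := pselect (X y).
  by rewrite (FG y _ _).1 ?eG ?Fx//; exact: XA.
have /andP[ay yb] := yab.
move: yx; rewrite ltr_norml => /andP[? ?].
have [xy|xy|xy] := ltgtP x y; last by rewrite xy.
  have [p /andP[xp py] [Xp pX]] := closed_last_point cX (ltW xy) Xx nXy.
  have Ap : A p by apply: XA => //; apply/andP; split; lra.
  have [|||t /andP[pt ty] At] := Ar p (y - p) => //.
  - by apply/andP; split; lra.
  - by lra.
  transitivity (F t).
    apply/esym/FX; [lra|lra|lra|move=> s /andP[? ?]; apply: pX].
    by apply/andP; split; lra.
  rewrite (FG t _ At).1; last by apply/andP; split; lra.
  by rewrite Fx eG// ltr_norml; apply/andP; split; lra.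
have [p /andP[yp px] [Xp pX]] := closed_first_point cX (ltW xy) nXy Xx.
have Ap : A p by apply: XA => //; apply/andP; split; lra.
have [|||t /andP[pt ty] At] := Al p (p - y) => //.
- by apply/andP; split; lra.
- by lra.
transitivity (F t).
  apply/FX; [lra|lra|lra|move=> s /andP[? ?]; apply: pX].
  by apply/andP; split; lra.
rewrite (FG t _ At).1; last by apply/andP; split; lra.
by rewrite Fx eG// ltr_norml; apply/andP; split; lra.
Qed.

End LocallyConstant.

(** * The index of rectangles and the category argument *)

Section RectangleIndex.
Context {R : realType}.
Implicit Types (m : R -> R -> int) (I J : R * R) (F : R -> R -> Prop) (h : R -> R)
  (C : set R).

Definition segment I : set R := [set x | I.1 <= x <= I.2].

Definition subsegment I J := [&& J.1 <= I.1, I.1 <= I.2 & I.2 <= J.2].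

Lemma subsegment_trans J I K : subsegment I J -> subsegment J K -> subsegment I K.
Proof.
move=> /and3P[JI1 I12 IJ2] /and3P[KJ1 _ JK2]; apply/and3P; split => //.
- exact: le_trans JI1.
- exact: le_trans JK2.
Qed.

Definition rectangle_index m I J : int :=
  m I.2 J.2 - m I.2 J.1 - m I.1 J.2 + m I.1 J.1.

(* [evadable m F] is what makes a Baire category argument possible: rectangles
   of nonzero index can be shrunk so as to avoid [F]. *)
Definition evadable m F := forall I J,
  subsegment I (0, 1) -> subsegment J (0, 1) -> rectangle_index m I J != 0 ->
  exists I' J', [/\ subsegment I' I, subsegment J' J, rectangle_index m I' J' != 0
    & forall x y, segment I' x -> segment J' y -> ~ F x y].

Lemma evadable0 m F : (forall x y, ~ F x y) -> evadable m F.
Proof.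
move=> nF I J /and3P[_ I12 _] /and3P[_ J12 _] IJ0; exists I, J; split => //.
- by rewrite /subsegment !lexx I12.
- by rewrite /subsegment !lexx J12.
Qed.

Lemma evadableS m F1 F2 : (forall x y, F2 x y -> F1 x y) ->
  evadable m F1 -> evadable m F2.
Proof.
move=> F21 ev I J I01 J01 IJ0; have [I' [J' [? ? ? nF]]] := ev I J I01 J01 IJ0.
by exists I', J'; split => // x y Ix Jy /F21; exact: nF.
Qed.

Lemma evadableU m F1 F2 : evadable m F1 -> evadable m F2 ->
  evadable m (fun x y => F1 x y \/ F2 x y).
Proof.
move=> ev1 ev2 I J I01 J01 IJ0.
have [I1 [J1 [I1I J1J IJ1 nF1]]] := ev1 I J I01 J01 IJ0.
have [I2 [J2 [I2I1 J2J1 IJ2 nF2]]] :=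
  ev2 I1 J1 (subsegment_trans I1I I01) (subsegment_trans J1J J01) IJ1.
exists I2, J2; split => //.
- exact: subsegment_trans I1I.
- exact: subsegment_trans J1J.
have seg I' I'' x : subsegment I' I'' -> segment I' x -> segment I'' x.
  move=> /and3P[l _ r] /andP[lx xr]; apply/andP; split.
  - exact: le_trans lx.
  - exact: le_trans r.
move=> x y I2x J2y [F1xy|F2xy]; last exact: nF2 F2xy.
by apply: nF1 F1xy; [exact: seg I2x | exact: seg J2y].
Qed.

(** The index is symmetric in the two variables, so sets defined through [f y] reduce to the case of
    [g x]. *)
Lemma evadable_swap m F : evadable (fun y x => m x y) (fun y x => F x y) ->
  evadable m F.
Proof.
have idxC I J : rectangle_index m I J = rectangle_index (fun y x => m x y) J I.
  by rewrite /rectangle_index; ring.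
move=> ev I J I01 J01; rewrite idxC => IJ0.
have [J' [I' [JJ' II' IJ0' nF]]] := ev J I J01 I01 IJ0.
exists I', J'; split => //; first by rewrite idxC.
by move=> x y Ix Jy; exact: nF.
Qed.

Lemma nested_segments (I : nat -> R * R) : (I 0%N).1 <= (I 0%N).2 ->
  (forall n, subsegment (I n.+1) (I n)) -> exists x, forall n, segment (I n) x.
Proof.
move=> I0 subI.
have subD n k : subsegment (I (n + k)%N) (I n).
  elim: k => [|k IHk]; last by rewrite addnS; exact: subsegment_trans IHk.
  rewrite addn0 /subsegment !lexx andbT/=.
  by case: n => // n; case/and3P: (subI n).
have le12 i j : (I i).1 <= (I j).2.
  have /and3P[i1 ij _] := subD i j; have /and3P[_ _ j2] := subD j i.
  by rewrite addnC in j2; exact: le_trans (le_trans i1 ij) j2.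
exists (sup (range (fun n => (I n).1))) => n; apply/andP; split.
  by apply: ub_le_sup; [exists (I 0%N).2 => _ [k _ <-] | exists n].
by apply: ge_sup => [|_ [k _ <-] //]; exists (I 0%N).1; exists 0%N.
Qed.

(** Dependent choice gives nested rectangles of nonzero index, the one at stage [n.+1] avoiding
    [F n]; compactness gives a common point. *)
Lemma evadable_bigcap m (F : nat -> R -> R -> Prop) :
  rectangle_index m (0, 1) (0, 1) != 0 -> (forall n, evadable m (F n)) ->
  exists x y, [/\ 0 <= x <= 1, 0 <= y <= 1 & forall n, ~ F n x y].
Proof.
move=> m0 ev.
pose P (Q : (R * R) * (R * R)) := [/\ subsegment Q.1 (0, 1),
  subsegment Q.2 (0, 1) & rectangle_index m Q.1 Q.2 != 0].
(* Pairing the stage with the current rectangle lets [choice] return a single successor function. *)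
have step (z : nat * {Q | P Q}) : exists Q' : {Q | P Q},
    [/\ subsegment (sval Q').1 (sval z.2).1, subsegment (sval Q').2 (sval z.2).2
      & forall x y, segment (sval Q').1 x -> segment (sval Q').2 y -> ~ F z.1 x y].
  case: z => n [[I J] [/= I01 J01 IJ0]].
  have [I' [J' [II' JJ' IJ0' nF]]] := ev n I J I01 J01 IJ0.
  have PIJ : P (I', J').
    by split => //=; [exact: subsegment_trans I01 | exact: subsegment_trans J01].
  by exists (exist _ _ PIJ).
have [next nextP] := choice step.
have P01 : P ((0, 1), (0, 1)) by split => //; rewrite /subsegment/= !lexx ler01.
pose u := fix u n := if n is k.+1 then next (k, u k) else exist P _ P01.
have [|n|x Ix] := @nested_segments (fun n => (sval (u n)).1); first by rewrite /= ler01.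
  by have [] := nextP (n, u n).
have [|n|y Jy] := @nested_segments (fun n => (sval (u n)).2); first by rewrite /= ler01.
  by have [] := nextP (n, u n).
exists x, y; split; [exact: Ix 0%N | exact: Jy 0%N |] => n.
by have [_ _] := nextP (n, u n); apply; [exact: (Ix n.+1) | exact: (Jy n.+1)].
Qed.

(** [m x J.2 - m x J.1] is the contribution to the index of the side at [x]. As [h] may be
    discontinuous, this need not be locally constant at points of [{h < k}], hence the auxiliary
    [G]. *)
Definition side_stable m h (k : R) J := exists G : R -> int,
  forall x, 0 <= x <= 1 -> h x < k ->
    m x J.2 - m x J.1 = G x /\ \forall t \near x, G t = G x.

(** [constant_off_closed] is applied to the side contribution with [A] equal to [{h < k}]: density
    supplies points of [A] on both sides, and index 0 off [C] gives constancy on the gaps. *)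
Lemma rectangle_index_eq0 m h (k : R) C I J : approximately_continuous h ->
  closed C -> (forall x, C x -> 0 <= x <= 1 -> h x < k) ->
  subsegment I (0, 1) -> side_stable m h k J ->
  (forall I', subsegment I' I -> (forall x, segment I' x -> ~ C x) ->
    rectangle_index m I' J = 0) ->
  rectangle_index m I J = 0.
Proof.
move=> h_ac cC Ch /and3P[/= I1 I12 I2] [G mG] idx0.
suff FE : m I.1 J.2 - m I.1 J.1 = m I.2 J.2 - m I.2 J.1.
  by rewrite /rectangle_index; lra.
pose A := [set x | 0 <= x <= 1 /\ h x < k].
apply: (@constant_off_closed _ _ (fun x => m x J.2 - m x J.1) G C A) => //.
- move=> x /andP[? ?] Cx; have x01 : 0 <= x <= 1 by apply/andP; split; lra.
  by split => //; exact: Ch.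
- move=> x d /andP[? ?] [_ hx] d0.
  have [|||t tx [t01 ht]] := @approximately_continuous_right _ h x (k - h x) d h_ac.
  + by apply/andP; split; lra.
  + by lra.
  + exact: d0.
  by exists t => //; split => //; move: ht; rewrite ltr_norml => /andP[? ?]; lra.
- move=> x d /andP[? ?] [_ hx] d0.
  have [|||t tx [t01 ht]] := @approximately_continuous_left _ h x (k - h x) d h_ac.
  + by apply/andP; split; lra.
  + by lra.
  + exact: d0.
  by exists t => //; split => //; move: ht; rewrite ltr_norml => /andP[? ?]; lra.
- by move=> x _ [x01 hx]; exact: mG.
move=> x y xI xy yI nC.
have := idx0 (x, y); rewrite /rectangle_index /subsegment/= xI xy yI => /(_ isT nC) E.
by apply/eqP; rewrite -subr_eq0 -oppr_eq0 -E; apply/eqP; ring.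
Qed.

(** By contraposition, cut at a height [z] strictly between [p] and [q]. The lower part misses
    [q <= y]; the upper part has its bottom above [p], hence above [h] on [C], so
    [rectangle_index_eq0] applies. *)
Lemma evadable_above m h C (p q : R) : p < q -> approximately_continuous h ->
  closed C -> (forall x, C x -> 0 <= x <= 1 -> h x <= p) ->
  (forall J, subsegment J (0, 1) -> side_stable m h J.1 J) ->
  evadable m (fun x y => C x /\ q <= y).
Proof.
move=> pq h_ac cC Ch m_st I J I01 J01; apply: contra_neqP => nex.
have avoid I' J' : subsegment I' I -> subsegment J' J ->
    (forall x y, segment I' x -> segment J' y -> ~ (C x /\ q <= y)) ->
    rectangle_index m I' J' = 0.
  by move=> ? ? ?; apply: contrapT => /eqP ?; apply: nex; exists I', J'.
have above J' : subsegment J' J -> p < J'.1 -> rectangle_index m I J' = 0.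
  move=> J'J pJ; apply: (@rectangle_index_eq0 m h J'.1 C) I01 _ _ => //.
  - by move=> x Cx x01; apply: le_lt_trans pJ; exact: Ch.
  - by apply: m_st; exact: subsegment_trans J01.
  by move=> I' I'I nC; apply: avoid => // x y /nC nCx _ [].
have /and3P[I1 I12 I2] := I01; have /and3P[J1 J12 J2] := J01.
pose z := (p + q) / 2; have [pJ|Jp] := ltP p J.1.
  by apply: above => //; rewrite /subsegment !lexx J12.
have [zJ|Jz] := leP J.2 z.
  apply: avoid; rewrite /subsegment ?lexx ?I12 ?J12// => x y _ /andP[_ yJ] [_ qy].
  by move: zJ; rewrite /z; lra.
have -> : rectangle_index m I J =
    rectangle_index m I (J.1, z) + rectangle_index m I (z, J.2).
  by rewrite /rectangle_index/=; ring.
have II : subsegment I I by rewrite /subsegment !lexx I12.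
have Jl : subsegment (J.1, z) J.
  by rewrite /subsegment/= lexx/=; apply/andP; split; move: Jz; rewrite /z; lra.
have Jr : subsegment (z, J.2) J.
  by rewrite /subsegment/= lexx andbT; apply/andP; split; move: Jz; rewrite /z; lra.
rewrite (avoid _ _ II Jl) ?(above _ Jr) ?addr0//=; first by rewrite /z; lra.
by move=> x y _ /andP[_ /= yz] [_ qy]; move: yz; rewrite /z; lra.
Qed.

(** Mirror image of [evadable_above], with [\- h] and the top side in place of [h] and the bottom
    side. *)
Lemma evadable_below m h C (p q : R) : q < p -> approximately_continuous h ->
  closed C -> (forall x, C x -> 0 <= x <= 1 -> (\- h) x <= - p) ->
  (forall J, subsegment J (0, 1) -> side_stable m (\- h) (- J.2) J) ->
  evadable m (fun x y => C x /\ y <= q).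
Proof.
move=> qp h_ac cC Ch m_st I J I01 J01; apply: contra_neqP => nex.
have avoid I' J' : subsegment I' I -> subsegment J' J ->
    (forall x y, segment I' x -> segment J' y -> ~ (C x /\ y <= q)) ->
    rectangle_index m I' J' = 0.
  by move=> ? ? ?; apply: contrapT => /eqP ?; apply: nex; exists I', J'.
have below J' : subsegment J' J -> J'.2 < p -> rectangle_index m I J' = 0.
  move=> J'J Jp; apply: (@rectangle_index_eq0 m (\- h) (- J'.2) C) I01 _ _ => //.
  - exact: approximately_continuousN.
  - move=> x Cx x01; apply: le_lt_trans (Ch _ Cx x01) _.
    by rewrite ltrN2; exact: Jp.
  - by apply: m_st; exact: subsegment_trans J01.
  by move=> I' I'I nC; apply: avoid => // x y /nC nCx _ [].
have /and3P[I1 I12 I2] := I01; have /and3P[J1 J12 J2] := J01.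
pose z := (p + q) / 2; have [Jp|pJ] := ltP J.2 p.
  by apply: below => //; rewrite /subsegment !lexx J12.
have [zJ|Jz] := leP z J.1.
  apply: avoid; rewrite /subsegment ?lexx ?I12 ?J12// => x y _ /andP[Jy _] [_ yq].
  by move: zJ; rewrite /z; lra.
have -> : rectangle_index m I J =
    rectangle_index m I (J.1, z) + rectangle_index m I (z, J.2).
  by rewrite /rectangle_index/=; ring.
have II : subsegment I I by rewrite /subsegment !lexx I12.
have Jl : subsegment (J.1, z) J.
  by rewrite /subsegment/= lexx/=; apply/andP; split; move: Jz; rewrite /z; lra.
have Jr : subsegment (z, J.2) J.
  by rewrite /subsegment/= lexx andbT; apply/andP; split; move: Jz; rewrite /z; lra.
rewrite (below _ Jl) ?(avoid _ _ II Jr) ?addr0//=; last by rewrite /z; lra.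
by move=> x y _ /andP[/= zy _] [_ yq]; move: zy; rewrite /z; lra.
Qed.

End RectangleIndex.

(** * The crossing count and its stability along sides *)

Section Crossing.
Context {R : realType}.
Implicit Types (f g : R -> R) (J : R * R).

(** The comparison jumps only at [z]; there [b] is false and hides the jump. *)
Lemma near_lt_and (x z : R) (b : bool) : (b -> x != z) ->
  \forall t \near x, (z < t) && b = (z < x) && b.
Proof.
case: b => [/(_ isT)|_]; last by near=> t; rewrite !andbF.
case: (ltgtP x z) => // [xz|zx] _; near=> t; rewrite !andbT.
  have tz : t < z by near: t; exact: lt_nbhsl.
  by rewrite ltNge (ltW tz).
by near: t; exact: lt_nbhsr.
Unshelve. all: by end_near. Qed.

Lemma near_le_and (x z : R) (b : bool) : (b -> x != z) ->
  \forall t \near x, (z <= t) && b = (z <= x) && b.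
Proof.
case: b => [/(_ isT)|_]; last by near=> t; rewrite !andbF.
case: (ltgtP x z) => // [xz|zx] _; near=> t; rewrite !andbT.
  by rewrite leNgt; apply/negbF; near: t; exact: lt_nbhsl.
by rewrite ltW//; near: t; exact: lt_nbhsr.
Unshelve. all: by end_near. Qed.

(* The second difference of [crossing f g] over a rectangle is the number of
   clockwise turns along its boundary of the vector field [(y - g x, x - f y)],
   counted by the crossings of the half-line [{0} x ]0, +oo[]; being a second
   difference, it is additive. *)
Definition crossing f g (x y : R) : int :=
  ((g x <= y) && (f (g x) < x))%:R - ((g x <= y) && (f y < x))%:R
  + ((f y < x) && (g (f y) <= y))%:R.

(** The corner [(1, 1)] contributes 1 and the others 0. At [(1, 0)], if [g 1 = 0] then
    [f 0 = f (g 1) < 1] and the first two terms cancel. *)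
Lemma crossing_index f g : set_fun `[0, 1] `[0, 1] f -> set_fun `[0, 1] `[0, 1] g ->
  (forall x, 0 <= x <= 1 -> f (g x) != x) ->
  rectangle_index (crossing f g) (0, 1) (0, 1) != 0.
Proof.
move=> f01 g01 fg.
have f0 x : 0 <= x <= 1 -> 0 <= f x <= 1.
  by move=> x01; have := f01 x; rewrite /= !in_itv/=; apply.
have g0 x : 0 <= x <= 1 -> 0 <= g x <= 1.
  by move=> x01; have := g01 x; rewrite /= !in_itv/=; apply.
have gf y : 0 <= y <= 1 -> g (f y) != y.
  by move=> y01; apply/eqP => gfy; have := fg _ (f0 _ y01); rewrite gfy eqxx.
have i0 : 0 <= (0 : R) <= 1 by rewrite lexx ler01.
have i1 : 0 <= (1 : R) <= 1 by rewrite lexx ler01.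
have nlt0 (x : R) : 0 <= x <= 1 -> (x < 0) = false.
  by move=> /andP[x0 _]; rewrite ltNge x0.
have lt1 : f (g 1) < 1.
  by rewrite lt_neqAle (fg _ i1); case/andP: (f0 _ (g0 _ i1)).
have gt0 : (g (f 0) <= 0) = false.
  apply/negbTE; rewrite -ltNge lt_neqAle eq_sym (gf _ i0).
  by case/andP: (g0 _ (f0 _ i0)).
have g11 : g 1 <= 1 by case/andP: (g0 _ i1).
have gf11 : g (f 1) <= 1 by case/andP: (g0 _ (f0 _ i1)).
have f00 := nlt0 _ (f0 _ i0); have f10 := nlt0 _ (f0 _ i1).
have fg00 := nlt0 _ (f0 _ (g0 _ i0)).
have g10 : g 1 <= 0 -> f 0 < 1.
  move=> g1; suff <- : g 1 = 0 by [].
  by apply/le_anti; rewrite g1; case/andP: (g0 _ i1).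
rewrite /rectangle_index /crossing /= lt1 gt0 g11 gf11 f00 f10 fg00 !andbF !andbT /=.
by case: (g 1 <= 0) g10 => [->//|_]; case: (f 1 < 1).
Qed.

Lemma near_natrB (b c : R -> bool) (x : R) :
  (\forall t \near x, b t = b x) -> (\forall t \near x, c t = c x) ->
  \forall t \near x, (b t)%:R - (c t)%:R = (b x)%:R - (c x)%:R :> int.
Proof. by apply: filterS2 => t -> ->. Qed.

(** For [g x < J.1] the first term of [crossing] is the same at both ends of [J], and the other two
    combine into [G]. A jump of [G] at [x] would need [x = f J.i] and [J.i < g x], against
    [g x < J.1]. *)
Lemma crossing_stable_above f g J : subsegment J (0, 1) ->
  side_stable (crossing f g) g J.1 J.
Proof.
move=> /and3P[_ J12 _]; exists (fun x =>
  ((f J.1 < x) && (J.1 < g (f J.1)))%:R - ((f J.2 < x) && (J.2 < g (f J.2)))%:R).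
move=> x x01 gx; have gx2 := lt_le_trans gx J12; split.
  rewrite /crossing (ltW gx) (ltW gx2) !(ltNge _ (g _)).
  by do 3!case: (_ < _); do 2!case: (_ <= _).
apply: near_natrB; apply: near_lt_and => gfJ; apply/eqP => xE.
  by move: gx; rewrite xE ltNge (ltW gfJ).
by move: gx2; rewrite xE ltNge (ltW gfJ).
Qed.

(** For [J.2 < g x] only the third term of [crossing] survives, and a jump would force
    [g x <= J.2]. *)
Lemma crossing_stable_below f g J : subsegment J (0, 1) ->
  side_stable (crossing f g) (\- g) (- J.2) J.
Proof.
move=> /and3P[_ J12 _]; exists (fun x =>
  ((f J.2 < x) && (g (f J.2) <= J.2))%:R - ((f J.1 < x) && (g (f J.1) <= J.1))%:R).
move=> x x01; rewrite ltrN2 => gx; have gx1 := le_lt_trans J12 gx; split.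
  rewrite /crossing !(leNgt (g x)) gx gx1.
  by do 3!case: (_ < _); do 2!case: (_ <= _).
apply: near_natrB; apply: near_lt_and => gfJ; apply/eqP => xE.
  by move: gx; rewrite xE ltNge gfJ.
by move: gx1; rewrite xE ltNge gfJ.
Qed.

(** For [f y < J.1] the third term cancels, and the first two combine into [G]. *)
Lemma crossing_stable_right f g J : subsegment J (0, 1) ->
  side_stable (fun y x => crossing f g x y) f J.1 J.
Proof.
move=> /and3P[_ J12 _]; exists (fun y =>
  ((g J.1 <= y) && (J.1 <= f (g J.1)))%:R - ((g J.2 <= y) && (J.2 <= f (g J.2)))%:R).
move=> y y01 fy; have fy2 := lt_le_trans fy J12; split.
  rewrite /crossing fy fy2 !(leNgt _ (f _)).
  by do 3!case: (_ <= _); do 2!case: (_ < _).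
apply: near_natrB; apply: near_le_and => fgJ; apply/eqP => yE.
  by move: fy; rewrite yE ltNge fgJ.
by move: fy2; rewrite yE ltNge fgJ.
Qed.

(** For [J.2 < f y] only the first term survives. *)
Lemma crossing_stable_left f g J : subsegment J (0, 1) ->
  side_stable (fun y x => crossing f g x y) (\- f) (- J.2) J.
Proof.
move=> /and3P[_ J12 _]; exists (fun y =>
  ((g J.2 <= y) && (f (g J.2) < J.2))%:R - ((g J.1 <= y) && (f (g J.1) < J.1))%:R).
move=> y y01; rewrite ltrN2 => fy; have fy1 := le_lt_trans J12 fy; split.
  rewrite /crossing !(ltNge (f y)) (ltW fy) (ltW fy1).
  by do 3!case: (_ <= _); do 2!case: (_ < _).
apply: near_natrB; apply: near_le_and => fgJ; apply/eqP => yE.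
  by move: fy; rewrite yE ltNge (ltW fgJ).
by move: fy1; rewrite yE ltNge (ltW fgJ).
Qed.

End Crossing.

(** * Rational thresholds and the fixed point *)

Lemma two_rats_between {R : realType} (x y : R) : x < y ->
  exists p q : rat, [/\ x < ratr p, ratr p < ratr q :> R & ratr q < y].
Proof.
move=> xy; have [p] := rat_in_itvoo xy; rewrite in_itv/= => /andP[xp py].
have [q] := rat_in_itvoo py; rewrite in_itv/= => /andP[pq qy].
by exists p, q.
Qed.

Theorem corollary2 (R : realType) (f g : R -> R)
    (f01 : set_fun `[0, 1] `[0, 1] f) (g01 : set_fun `[0, 1] `[0, 1] g)
    (f_ac : approximately_continuous f) (g_ac : approximately_continuous g) :
  exists x : R, x \in `[0, 1] /\ f (g x) = x.
Proof.
apply: contrapT => nfix.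
have fg x : 0 <= x <= 1 -> f (g x) != x.
  by move=> x01; apply/eqP => fgx; apply: nfix; exists x; rewrite in_itv.
have [Cf Cf_spec] := choice (fun p => approximately_continuous_Fsigma p f_ac).
have [Cg Cg_spec] := choice (fun p => approximately_continuous_Fsigma p g_ac).
have [Df Df_spec] :=
  choice (fun p => approximately_continuous_Fsigma p (approximately_continuousN f_ac)).
have [Dg Dg_spec] :=
  choice (fun p => approximately_continuous_Fsigma p (approximately_continuousN g_ac)).
(* The four alternatives witness [g x < y], [y < g x], [f y < x] and [x < f y] with the gap from [p]
   to [q]; [Dg (- q)] and [Df (- q)] encode [q <= g x] and [q <= f y]. *)
pose F0 (p q : R) k x y := ((Cg p k x /\ q <= y) \/ (Dg (- q) k x /\ y <= p)) \/
  ((Cf p k y /\ q <= x) \/ (Df (- q) k y /\ x <= p)).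
have F0_ev p q k : p < q -> evadable (crossing f g) (F0 p q k).
  move=> pq; have [cCf Cfle _] := Cf_spec p; have [cCg Cgle _] := Cg_spec p.
  have [cDf Dfle _] := Df_spec (- q); have [cDg Dgle _] := Dg_spec (- q).
  apply: evadableU; apply: evadableU.
  - by apply: (evadable_above pq g_ac (cCg k) (Cgle k)); exact: crossing_stable_above.
  - by apply: (evadable_below pq g_ac (cDg k) (Dgle k)); exact: crossing_stable_below.
  - apply: evadable_swap.
    by apply: (evadable_above pq f_ac (cCf k) (Cfle k)); exact: crossing_stable_right.
  - apply: evadable_swap.
    by apply: (evadable_below pq f_ac (cDf k) (Dfle k)); exact: crossing_stable_left.
(* Rational thresholds make the family countable; codes that are invalid or have [q <= p] give the
   empty set. *)
pose F n (x y : R) := if unpickle n is Some (p, q, k) then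
  ratr p < ratr q :> R /\ F0 (ratr p) (ratr q) k x y else False.
have [n|x [y [x01 y01 nF]]] :=
    @evadable_bigcap R _ F (crossing_index f01 g01 fg).
  rewrite /F; case: unpickle => [[[p q] k]|]; last by apply: evadable0 => x y [].
  have [pq|qp] := ltP (ratr p : R) (ratr q).
    by move: (F0_ev _ _ k pq); apply: evadableS => x y [].
  by apply: evadable0 => x y [].
have {}nF p q k : ratr p < ratr q :> R -> ~ F0 (ratr p) (ratr q) k x y.
  by move=> pq F0xy; apply: (nF (pickle (p, q, k))); rewrite /F pickleK.
(* Each strict inequality would put [(x, y)] into some [F0]; what remains is [g x = y] and
   [f y = x], a fixed point. *)
have [gxy|ygx|gxy] := ltgtP (g x) y.
- have [p [q [gp pq qy]]] := two_rats_between gxy.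
  have [_ _ /(_ x x01 gp)[k Ck]] := Cg_spec (ratr p).
  by apply: (nF p q k pq); left; left; split => //; exact: ltW.
- have [p [q [yp pq qg]]] := two_rats_between ygx.
  have [_ _ /(_ x x01)[|k Ck]] := Dg_spec (- ratr q); first by rewrite ltrN2.
  by apply: (nF p q k pq); left; right; split => //; exact: ltW.
have [fyx|xfy|fyx] := ltgtP (f y) x.
- have [p [q [fp pq qx]]] := two_rats_between fyx.
  have [_ _ /(_ y y01 fp)[k Ck]] := Cf_spec (ratr p).
  by apply: (nF p q k pq); right; left; split => //; exact: ltW.
- have [p [q [xp pq qf]]] := two_rats_between xfy.
  have [_ _ /(_ y y01)[|k Ck]] := Df_spec (- ratr q); first by rewrite ltrN2.
  by apply: (nF p q k pq); right; right; split => //; exact: ltW.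
by have := fg _ x01; rewrite gxy fyx eqxx.
Qed.
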